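(* Consider the interconnected system $\dot x_i = f_i(x)+g_i(x)u_i$, $i=1,\dots,N$, with safety function $h$, safety set $\mathcal{C}=\{x: h(x)\ge 0\}$, margin $c>0$ and $\mathcal{C}_c=\{x: h(x)\ge c\}$. Consider an attack cycle $[t_0,t_f]$ in which each subsystem is compromised at most once. Assume $x(t_0)\in\mathcal{C}_c$ and that the nominal policy $\hat u=(\hat u_1,\dots,\hat u_N)$ satisfies the nominal-policy assumption stated in the context. Let each subsystem $S_i$ employ the resilient architecture $M(S_i)$, with recovery time $t(M(S_i))$. Let $K$ be a positive integer, $\Delta=c/K$, $\mathcal{C}_j=\{x:(j-1)\Delta\le h(x)\le j\Delta\}$ for $j=1,\dots,K$, and let $\rho_{ij}<0$ be scalars such that for all $i=1,\dots,N$ and $j=1,\dots,K$ $$\frac{\partial h}{\partial x_i}(x)\, g_i(x)\,(u_i-\hat u_i(x))\ \ge\ \rho_{ij}\qquad \text{for all } x\in\mathcal{C}_j \text{ and all } u_i\in\mathcal{U}_i .$$ Let $D_i$ be the degradation function built from $\rho_{i1},\dots,\rho_{iK}$ as defined in the context, and suppose each $t(M(S_i))$ lies in the domain of $D_i$. If $$\sum_{i=1}^N D_i\big(t(M(S_i))\big) + c \ \ge\ 0,$$ then the system is safe during the attack cycle, i.e. $x(t)\in\mathcal{C}$ for all $t\in[t_0,t_f]$.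
   Context: System: there are $N$ subsystems $\mathcal{S}=\{S_1,\dots,S_N\}$ with states $x_i\in\mathbb{R}^{n_i}$, $x=[x_1^T\cdots x_N^T]^T\in\mathbb{R}^n$, $n=\sum_i n_i$, and dynamics $\dot x_i=f_i(x)+g_i(x)u_i$, where $f_i:\mathbb{R}^n\to\mathbb{R}^{n_i}$ and $g_i:\mathbb{R}^n\to\mathbb{R}^{n_i\times r_i}$ are Lipschitz continuous. Inputs satisfy $u_i\in\mathcal{U}_i=\prod_{j=1}^{r_i}[\underline u_{i,j},\overline u_{i,j}]$ with $\underline u_{i,j}<\overline u_{i,j}$. Inputs are measurable functions of time and trajectories are absolutely continuous solutions of the ODE. The nominal control policy of $S_i$ is a map $\hat u_i=\mu_i:\mathbb{R}^n\to\mathcal{U}_i$. Safety: $h:\mathbb{R}^n\to\mathbb{R}$ is continuously differentiable; $\frac{\partial h}{\partial x_i}$ is the row vector of partial derivatives with respect to the components of $x_i$; $\mathcal{C}=\{x:h(x)\ge 0\}$. The system is safe at time $t$ if $x(t)\in\mathcal{C}$. Nominal-policy assumption: with $\alpha$ an extended class-$\mathcal{K}$ function (continuous, strictly increasing, $\alpha(0)=0$) and a constant $\tau>0$, $$\sum_{i=1}^N \frac{\partial h}{\partial x_i}\big(f_i(x)+g_i(x)\hat u_i(x)\big)\ge -\alpha(h(x)-c)\quad\forall x\in\mathcal{C}_c,$$ $$\sum_{i=1}^N \frac{\partial h}{\partial x_i}\big(f_i(x)+g_i(x)\hat u_i(x)\big)\ge \frac{c}{\tau}\quad\forall x\in\mathcal{C}\setminus\mathcal{C}_c.$$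 Architectures and attacks: there is a finite set $\mathcal{A}=\{A_1,\dots,A_J\}$ of resilient architectures, each with a guaranteed recovery time $t(A_j)\ge 0$, and an assignment map $M:\mathcal{S}\to\mathcal{A}$. In an attack cycle $[t_0,t_f]$, each subsystem $S_i$ may be compromised at most once, on a time interval contained in $[t_0,t_f]$ whose length is at most $t(M(S_i))$; these intervals may have arbitrary order and overlap. While $S_i$ is compromised, $u_i(t)$ is an arbitrary corrupted input in $\mathcal{U}_i$; whenever $S_i$ is not compromised, $u_i(t)=\hat u_i(x(t))$. By time $t_f$ all compromised subsystems have recovered. Degradation function: let $\rho'_{i1}\le\rho'_{i2}\le\dots\le\rho'_{iK}$ be the sorted (ascending) rearrangement of $\rho_{i1},\dots,\rho_{iK}$. For $m=0,1,\dots,K$ put $\theta_{i,m}=-\Delta\sum_{j=1}^{m}\frac{1}{\rho'_{ij}}$ (so $\theta_{i,0}=0$). Then $D_i$ is the piecewise linear function $$D_i(T)=-(m-1)\Delta+\rho'_{im}\,(T-\theta_{i,m-1})\quad\text{for } \theta_{i,m-1}\le T\le\theta_{i,m},\ m=1,\dots,K,$$ where for $K\ge2$ the last interval ($m=K$) is taken as $(\theta_{i,K-1},\theta_{i,K})$, so the domain is $[0,\theta_{i,K})$; for $K=1$, $D_i(T)=\rho_{i1}T$ on $[0,-\Delta/\rho_{i1}]$. *)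

(* Defs.v *)
From HB Require Import structures.
From mathcomp Require Export all_boot all_order all_algebra.
From mathcomp Require Export all_classical all_reals all_analysis.
Set Implicit Arguments.
Unset Strict Implicit.
Unset Printing Implicit Defensive.
Import Order.TTheory GRing.Theory Num.Theory numFieldNormedType.Exports.
Local Open Scope classical_set_scope.
Local Open Scope ring_scope.

(* The state x = [x_1^T ... x_N^T]^T is a column of size \sum_i n i; its block
   x_i is [submxcol x i], whose k-th entry is the entry of x at index
   [tagnat.Rank i k]. *)
Notation state R n := ('cV[R]_(\sum_i n i)).

(* The row vector dh/dx_i at x. *)
Definition block_grad (R : realType) (N : nat) (n : 'I_N -> nat)
    (h : state R n -> R) (i : 'I_N) (x : state R n) : 'rV[R]_(n i) :=
  \row_(k < n i) 'D_(delta_mx (tagnat.Rank i k) 0) h x.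

(* The domain being finite dimensional, continuity of x |-> 'd h x amounts to
   continuity of x |-> 'D_v h x for every fixed v. *)
Definition continuously_differentiable (R : realType) (N : nat)
    (n : 'I_N -> nat) (h : state R n -> R) : Prop :=
  (forall x, differentiable h x) /\
  (forall v, continuous (fun x => 'D_v h x)).

Definition superlevel (R : realType) (T : Type) (h : T -> R) (c : R) : set T :=
  [set x | c <= h x].

Definition band (R : realType) (T : Type) (h : T -> R) (a b : R) : set T :=
  [set x | a <= h x <= b].

Definition extended_class_K (R : realType) (alpha : R -> R) : Prop :=
  [/\ continuous alpha, {homo alpha : s t / s < t} & alpha 0 = 0].

Definition input_box (R : realType) (r : nat) (lo hi : 'cV[R]_r) :
    set 'cV[R]_r :=
  [set v | forall j, lo j 0 <= v j 0 <= hi j 0].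

Definition absolutely_continuous (R : realType) (V : normedModType R)
    (a b : R) (F : R -> V) : Prop :=
  forall e : R, 0 < e -> exists2 d : R, 0 < d &
    forall (m : nat) (s t : 'I_m -> R),
      (forall k, a <= s k /\ s k <= t k /\ t k <= b) ->
      trivIset setT (fun k => [set` `]s k, t k[]) ->
      \sum_(k < m) (t k - s k) < d ->
      \sum_(k < m) `|F (t k) - F (s k)| < e.

(* Absolutely continuous solution on [t0, tf] of
   x_i' = f_i(x) + g_i(x) u_i, i < N, the equations holding almost everywhere.
   The values of x and u outside [t0, tf] are irrelevant. *)
Definition trajectory (R : realType) (N : nat) (n r : 'I_N -> nat)
    (f : forall i, state R n -> 'cV[R]_(n i))
    (g : forall i, state R n -> 'M[R]_(n i, r i))
    (t0 tf : R) (u : forall i, R -> 'cV[R]_(r i)) (x : R -> state R n) : Prop :=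
  absolutely_continuous t0 tf x /\
  forall i, {ae (@lebesgue_measure R), forall t, t0 < t < tf ->
    is_derive t (1 : R) (fun s => submxcol (x s) i)
      (f i (x t) + g i (x t) *m u i t)}.

(* [comp i] is the time interval on which the i-th subsystem is compromised;
   it is empty when that subsystem is never compromised. [len i] is the
   recovery time guaranteed by its architecture. *)
Definition attack_cycle (R : realType) (N : nat) (n r : 'I_N -> nat)
    (lo hi : forall i, 'cV[R]_(r i)) (mu : forall i, state R n -> 'cV[R]_(r i))
    (len : 'I_N -> R) (t0 tf : R) (comp : 'I_N -> interval R)
    (u : forall i, R -> 'cV[R]_(r i)) (x : R -> state R n) : Prop :=
  forall i,
    [/\ [set` comp i] `<=` [set` `[t0, tf]],
        (lebesgue_measure [set` comp i] <= (len i)%:E)%E,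
        forall j, measurable_fun [set` `[t0, tf]] (fun t => u i t j 0),
        forall t, t \in comp i -> input_box (lo i) (hi i) (u i t)
      & forall t, t0 <= t <= tf -> t \notin comp i -> u i t = mu i (x t)].

(* Below the slopes rho'_1 <= ... <= rho'_K are indexed from 0, so that
   rho'_(m+1) is (slopes rho)`_m. *)
Definition slopes (R : realType) (K : nat) (rho : 'I_K -> R) : seq R :=
  sort <=%R (codom rho).

Definition theta (R : realType) (K : nat) (Delta : R) (rho : 'I_K -> R)
    (m : nat) : R :=
  - Delta * \sum_(0 <= j < m) ((slopes rho)`_j)^-1.

(* The piece used at T is the first m with T <= theta (m + 1);
   [degradationE] shows that adjacent pieces agree at breakpoints. *)
Definition degradation (R : realType) (K : nat) (Delta : R) (rho : 'I_K -> R)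
    (T : R) : R :=
  let m := find (fun m => T <= theta Delta rho m.+1) (iota 0 K) in
  - (m%:R * Delta) + (slopes rho)`_m * (T - theta Delta rho m).

Definition degradation_dom (R : realType) (K : nat) (Delta : R)
    (rho : 'I_K -> R) : set R :=
  [set T | 0 <= T /\
    if K == 1%N then T <= theta Delta rho 1 else T < theta Delta rho K].

Lemma slopes_lt0 (R : realType) (K : nat) (rho : 'I_K -> R) (m : nat) :
  (forall j, rho j < 0) -> (m < K)%N -> (slopes rho)`_m < 0.
Proof.
move=> rho0 mK; have : (slopes rho)`_m \in codom rho.
  by rewrite -(mem_sort <=%R) mem_nth// size_sort size_codom card_ord.
by move=> /codomP[j ->].
Qed.

Lemma thetaS (R : realType) (K : nat) (Delta : R) (rho : 'I_K -> R) (m : nat) :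
  theta Delta rho m.+1 = theta Delta rho m - Delta / (slopes rho)`_m.
Proof. by rewrite /theta big_nat_recr//= mulrDr mulNr mulNr. Qed.

Lemma theta_lt (R : realType) (K : nat) (Delta : R) (rho : 'I_K -> R)
    (l m : nat) :
  0 < Delta -> (forall j, rho j < 0) -> (l < m <= K)%N ->
  theta Delta rho l < theta Delta rho m.
Proof.
move=> D0 rho0; elim: m => // m IH /andP[lm mK].
have lt_m : theta Delta rho m < theta Delta rho m.+1.
  by rewrite thetaS ltrDl oppr_gt0 pmulr_rlt0// invr_lt0 slopes_lt0.
move: lm; rewrite ltnS leq_eqVlt => /predU1P[->//|lm].
by rewrite (lt_trans _ lt_m)// IH// lm ltnW.
Qed.

Lemma degradationE (R : realType) (K : nat) (Delta : R) (rho : 'I_K -> R)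
    (T : R) (m : nat) :
  0 < Delta -> (forall j, rho j < 0) -> (m < K)%N ->
  theta Delta rho m <= T <= theta Delta rho m.+1 ->
  degradation Delta rho T =
  - (m%:R * Delta) + (slopes rho)`_m * (T - theta Delta rho m).
Proof.
move=> D0 rho0 mK /andP[mT Tm]; rewrite /degradation.
set p := fun m => _; set l := find p _.
have hasp : has p (iota 0 K) by apply/hasP; exists m; rewrite ?mem_iota.
have lK : (l < K)%N by move: hasp; rewrite has_find size_iota.
have pl : T <= theta Delta rho l.+1.
  by have := nth_find 0%N hasp; rewrite -/l nth_iota.
have := leqNgt l m; have -> : (m < l)%N = false.
  apply/negP => ml; have := before_find 0%N ml.
  by rewrite nth_iota// /p /= add0n Tm.
rewrite /= leq_eqVlt => /predU1P[->//|lm].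
have ml : m = l.+1.
  apply/eqP; rewrite eqn_leq lm andbT leqNgt; apply/negP => l1m.
  have /(theta_lt D0 rho0) : (l.+1 < m <= K)%N by rewrite l1m ltnW.
  by rewrite ltNge (le_trans mT pl).
have -> : T = theta Delta rho m by apply/eqP; rewrite eq_le mT {1}ml pl.
rewrite subrr mulr0 addr0 ml thetaS addrAC subrr add0r mulrN.
rewrite mulrCA divff ?lt_eqF ?slopes_lt0// mulr1.
by rewrite -opprD -[in RHS]natr1 mulrDl mul1r.
Qed.

(* Main.v *)
(* If h became negative along the trajectory, then for each band C_j there would
   be a time interval ]b_j, a_j[ during which h stays in C_j and at whose
   endpoints it has dropped by exactly Delta, and these K intervals would be
   disjoint. Let tau_ij be the time during which S_i is compromised in the j-th
   interval. As the nominal part of dh/dt is at least c/tau > 0 below the level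
   c, integrating gives sum_i rho_ij tau_ij < - Delta for every j, while
   sum_j tau_ij <= t(M(S_i)). On the other hand D_i(T) is minus the value of a
   fractional knapsack: the largest loss S_i can cause in time T when the loss
   in each band is capped at Delta. Capping every rho_ij tau_ij at - Delta still
   leaves a total loss of at least Delta per band, so
   sum_i D_i(t(M(S_i))) < - c. *)
Require Import Defs.
From mathcomp Require Import measurable_realfun ring lra.
Import Order.TTheory GRing.Theory Num.Theory numFieldNormedType.Exports.
Local Open Scope classical_set_scope.
Local Open Scope ring_scope.
Set Implicit Arguments.
Unset Strict Implicit.
Unset Printing Implicit Defensive.

(** * Degradation as a fractional knapsack *)

Lemma sum_slopes (R : realType) (K : nat) (rho : 'I_K -> R) (G : R -> R) :
  \sum_(j < K) G (rho j) = \sum_(0 <= k < K) G (slopes rho)`_k.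
Proof.
transitivity (\sum_(y <- slopes rho) G y).
  have -> : \sum_(y <- slopes rho) G y = \sum_(y <- codom rho) G y.
    by apply: perm_big; rewrite perm_sort.
  by rewrite /codom /image_mem big_map big_enum.
by rewrite (big_nth 0) size_sort size_codom card_ord.
Qed.

Lemma slopes_le (R : realType) (K : nat) (rho : 'I_K -> R) (k m : nat) :
  (k <= m < K)%N -> (slopes rho)`_k <= (slopes rho)`_m.
Proof.
move=> /andP[km mK]; have sz : size (slopes rho) = K.
  by rewrite size_sort size_codom card_ord.
apply: (sorted_leq_nth le_trans lexx) => //.
- exact: sort_le_sorted.
- by rewrite inE sz (leq_ltn_trans km).
- by rewrite inE sz.
Qed.

Lemma theta_bracket (R : realType) (K : nat) (Delta : R) (rho : 'I_K -> R)
    (T : R) :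
  (0 < K)%N -> 0 <= T <= theta Delta rho K ->
  exists2 m, (m < K)%N & theta Delta rho m <= T <= theta Delta rho m.+1.
Proof.
move=> K0 /andP[T0 TK].
have h : exists m, (0 < m)%N && (T <= theta Delta rho m).
  by exists K; rewrite K0.
case: (ex_minnP h) => -[//|m] /andP[_ Tm] min_m; exists m.
  rewrite ltnNge; apply/negP => Km.
  by have := min_m K; rewrite K0 TK ltnNge Km => /(_ isT).
rewrite Tm andbT; case: m Tm min_m => [|m] Tm min_m.
  by rewrite /theta big_geq// mulr0.
rewrite leNgt; apply/negP => /ltW Tm'.
by have := min_m m.+1; rewrite Tm' ltnn => /(_ isT).
Qed.

(* The degradation at [T] is the value of a fractional knapsack: the largest
   loss that time [T] can buy when each band absorbs at most [Delta]. The slope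
   [l] of the piece containing [T] is the dual variable. *)
Lemma degradation_le (R : realType) (K : nat) (Delta : R) (rho : 'I_K -> R)
    (T : R) (s : 'I_K -> R) :
  (0 < K)%N -> 0 < Delta -> (forall j, rho j < 0) ->
  0 <= T <= theta Delta rho K ->
  (forall j, 0 <= s j) -> (forall j, - Delta <= rho j * s j) ->
  exists2 l, l < 0 & degradation Delta rho T <=
    \sum_(j < K) rho j * s j + l * (T - \sum_(j < K) s j).
Proof.
move=> K0 D0 rho0 T0K s0 sD; have [m mK mT] := theta_bracket K0 T0K.
set l := (slopes rho)`_m; have l0 : l < 0 by exact: slopes_lt0.
exists l => //; rewrite (degradationE D0 rho0 mK mT) -/l.
(* [G r] is the minimum of [(r - l) * s] over [0 <= s <= - Delta / r]: the cap is optimal for slopes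
   steeper than [l], and [s = 0] for the others. Adding [l * T] to the sum of these minima gives the
   value of the degradation at [T]. *)
pose G r := if r < l then (r - l) * (- (Delta / r)) else 0.
have GE : \sum_(j < K) G (rho j) = - (m%:R * Delta) - l * theta Delta rho m.
  rewrite sum_slopes (big_cat_nat (n := m))//=; last exact: ltnW.
  rewrite [X in _ + X]big_nat_cond [X in _ + X]big1 ?addr0; last first.
    move=> k /[!andbT] /andP[mk kK]; rewrite /G ltNge slopes_le//.
    by rewrite mk.
  rewrite (eq_big_nat _ _
    (F2 := fun k => - Delta + l * Delta * ((slopes rho)`_k)^-1)).
    rewrite big_split/= -mulr_sumr sumr_const_nat subn0 /theta.
    by rewrite mulNrn -mulr_natl; ring.
  move=> k /andP[_ km]; have k0 : (slopes rho)`_k < 0.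
    by apply: slopes_lt0 => //; exact: ltn_trans mK.
  have kl : (slopes rho)`_k <= l by apply: slopes_le; rewrite ltnW.
  have knz := ltr0_neq0 k0.
  (* A slope of index below [m] may be equal to [l]; the closed form then vanishes, as [G] does. *)
  rewrite /G; case: ltP => [_|lk]; first by field.
  have -> : l = (slopes rho)`_k by apply/le_anti; rewrite kl lk.
  by field.
have Gle : \sum_(j < K) G (rho j) <= \sum_(j < K) (rho j - l) * s j.
  apply: ler_sum => j _; rewrite /G; have rj := rho0 j; case: ltP => [rl|lr].
    rewrite ler_nM2l ?subr_lt0//.
    by rewrite -mulNr ler_ndivlMr// mulrC.
  by rewrite mulr_ge0// subr_ge0.
have sumE : \sum_(j < K) (rho j - l) * s j =
    \sum_(j < K) rho j * s j - l * \sum_(j < K) s j.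
  by rewrite mulr_sumr -sumrB; apply: eq_bigr => j _; rewrite mulrBl.
move: Gle; rewrite GE sumE; lra.
Qed.

(** Each time is cut at the point where its own loss reaches [Delta]. The cut times [s] are feasible
    for every knapsack and still lose at least [Delta] in each band, so summing over subsystems or
    over bands bounds the same double sum. *)
Lemma sum_degradation_lt (R : realType) (N K : nat) (Delta : R)
    (rho : 'I_N -> 'I_K -> R) (T : 'I_N -> R) (tau : 'I_N -> 'I_K -> R) :
  (0 < K)%N -> 0 < Delta -> (forall i j, rho i j < 0) ->
  (forall i, 0 <= T i <= theta Delta (rho i) K) ->
  (forall i j, 0 <= tau i j) -> (forall i, \sum_(j < K) tau i j <= T i) ->
  (forall j, \sum_(i < N) rho i j * tau i j < - Delta) ->
  \sum_(i < N) degradation Delta (rho i) (T i) < - (K%:R * Delta).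
Proof.
move=> K0 D0 rho0 TK tau0 tauT loss.
pose s i j := Num.min (tau i j) (- Delta / rho i j).
have capE i j : rho i j * (- Delta / rho i j) = - Delta.
  by rewrite mulrC mulfVK// lt_eqF.
have cap0 i j : 0 <= - Delta / rho i j.
  by rewrite mulNr -mulrN -invrN divr_ge0// ?ltW// oppr_gt0.
have s0 i j : 0 <= s i j by rewrite le_min tau0 cap0.
have s_tau i j : s i j <= tau i j by rewrite ge_min lexx.
have s_cap i j : - Delta <= rho i j * s i j.
  by rewrite -(capE i j) ler_nM2l// ge_min lexx orbT.
have rs0 i j : rho i j * s i j <= 0 by rewrite nmulr_rle0.
(* A single capped subsystem already loses [Delta] in the band; if none is capped, nothing was cut
   and [loss] applies. *)
have s_loss j : \sum_(i < N) rho i j * s i j <= - Delta.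
  have [[i capped]|uncapped] := pselect (exists i, - Delta / rho i j <= tau i j).
    rewrite (bigD1 i)//= -[leRHS]addr0 lerD//; last exact: sumr_le0.
    by rewrite /s (min_idPr capped) capE.
  rewrite (le_trans _ (ltW (loss j)))//; apply: ler_sum => i _.
  rewrite /s (min_idPl _)// leNgt; apply/negP => /ltW h.
  by apply: uncapped; exists i.
have sT i : \sum_(j < K) s i j <= T i.
  by rewrite (le_trans _ (tauT i))//; apply: ler_sum.
have /choice[l lP] i : exists l, l < 0 /\ degradation Delta (rho i) (T i) <=
    \sum_(j < K) rho i j * s i j + l * (T i - \sum_(j < K) s i j).
  have [l] := degradation_le K0 D0 (rho0 i) (TK i) (s0 i) (s_cap i).
  by exists l.
have Dle i : degradation Delta (rho i) (T i) <= \sum_(j < K) rho i j * s i j.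
  have [l0 h] := lP i; rewrite (le_trans h)// gerDl nmulr_rle0// subr_ge0//.
have sumD : \sum_(j < K) - Delta = - (K%:R * Delta).
  by rewrite sumr_const card_ord mulNrn mulr_natl.
have [[i slack]|tight] := pselect (exists i, \sum_(j < K) s i j < T i).
  rewrite -sumD (@lt_le_trans _ _ (\sum_(i < N) \sum_(j < K) rho i j * s i j))//.
    rewrite (bigD1 i)//= [ltRHS](bigD1 i)//= ltr_leD//; last exact: ler_sum.
    have [l0 h] := lP i; rewrite (le_lt_trans h)// gtrDl nmulr_rlt0// subr_gt0//.
  by rewrite exchange_big/=; apply: ler_sum.
have s_tauE i j : s i j = tau i j.
  have h k : 0 <= tau i k - s i k by rewrite subr_ge0.
  have : \sum_(k < K) (tau i k - s i k) = 0.
    apply/eqP; rewrite eq_le sumr_ge0// andbT sumrB subr_le0.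
    rewrite (le_trans (tauT i))// leNgt; apply/negP => sl.
    by apply: tight; exists i.
  move=> /(psumr_eq0P (fun k _ => h k))/(_ j isT)/eqP.
  by rewrite subr_eq0 => /eqP.
rewrite -sumD (@le_lt_trans _ _ (\sum_(j < K) \sum_(i < N) rho i j * s i j))//.
  by rewrite exchange_big/=; apply: ler_sum.
apply: ltr_sum.
  by apply/hasP; exists (Ordinal K0) => //; rewrite mem_index_enum.
by move=> j _; under eq_bigr do rewrite s_tauE.
Qed.

(** * Descents through the bands *)

(** The time [a] is the infimum of the times in [[p, q]] at which [H] is at most [B]. Continuity
    puts [a] in that set, and a value below [B] at [a] would force an earlier hit by the
    intermediate value theorem. *)
Lemma first_hit (R : realType) (H : R -> R) (B p q : R) :
  continuous H -> p <= q -> B < H p -> H q <= B ->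
  exists a, [/\ p < a <= q, H a = B & forall t, p <= t < a -> B < H t].
Proof.
move=> cH pq Bp qB.
pose S := [set t | p <= t <= q /\ H t <= B].
have Sq : S q by split=> //; rewrite pq lexx.
have hS : has_inf S by split; [exists q|exists p => t [/andP[]]].
set a := inf S.
have pa : p <= a by apply: lb_le_inf => [|t [/andP[]]//]; exists q.
have aq : a <= q by apply: ge_inf => //; exists p => t [/andP[]].
have before t : p <= t < a -> B < H t.
  move=> /andP[pt ta]; rewrite ltNge; apply/negP => tB.
  have : a <= t.
    apply: ge_inf; first by exists p => ? [/andP[]].
    by split=> //; rewrite pt (le_trans (ltW ta)).
  by rewrite leNgt ta.
have aB : H a <= B.
  rewrite leNgt; apply/negP => Ba.
  have : \forall t \near a, B < H t by exact: (cvgr_gt _ (cH a)).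
  move=> /nbhs_ballP[e /= e0 eB].
  have [t St te] := inf_adherent e0 hS.
  have at_ : a <= t by apply: ge_inf => //; exists p => ? [/andP[]].
  have : B < H t.
    rewrite -/a in te.
    by apply: eB; rewrite /ball/= ltr_norml; apply/andP; split; lra.
  by case: St => _; rewrite leNgt => /negP.
have pa' : p < a.
  rewrite lt_neqAle pa andbT; apply/eqP => pa_; by move: Bp; rewrite pa_ ltNge aB.
exists a; split; rewrite ?pa'//.
apply/eqP; rewrite eq_le aB/= leNgt; apply/negP => aB'.
have [|t] := @IVT R H p a B pa (continuous_subspaceT cH).
  by rewrite ge_min le_max aB (ltW Bp) orbT.
rewrite in_itv/= => /andP[pt ta] HtB.
have : t < a.
  by rewrite lt_neqAle ta andbT; apply/eqP => E; move: aB'; rewrite -E HtB ltxx.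
by move=> {}ta; have := before t; rewrite pt ta HtB ltxx => /(_ isT).
Qed.

(** Here [a] is the first time at level [A], and [b] the last time before it at level [B]. The
    latter is a first hit of [fun t => - H (- t)], which reverses time and exchanges up and down. *)
Lemma first_descent (R : realType) (H : R -> R) (A B p q : R) :
  continuous H -> A < B -> p <= q -> B <= H p -> H q <= A ->
  exists b a, [/\ p <= b, b < a, a <= q, H b = B & H a = A /\
    forall t, b < t < a -> A < H t < B].
Proof.
move=> cH AB pq Bp qA.
have [a [/andP[pa aq] Ha before]] := first_hit cH pq (lt_le_trans AB Bp) qA.
have cH' : continuous (fun t => - H (- t)).
  move=> t; apply: cvgN; apply: continuous_comp; first exact: opp_continuous.
  exact: cH.
have [||| b [/andP[ab bp] Hb after]] := @first_hit R _ (- B) (- a) (- p) cH'.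
- by rewrite lerN2 ltW.
- by rewrite opprK Ha ltrN2.
- by rewrite opprK lerN2.
exists (- b), a; split => //.
- by rewrite lerNr.
- by rewrite ltrNl.
- by apply: oppr_inj.
split=> // t /andP[bt ta]; rewrite before ?ta ?andbT/=; last first.
  by rewrite (le_trans _ (ltW bt))// lerNr.
have := after (- t); rewrite lerN2 ltrNl (ltW ta) bt opprK ltrN2.
by apply.
Qed.

(* The second clause says that the intervals ]b j, a j[ are disjoint, in the form
   needed to add up their images by a clock [phi]. *)
Lemma band_descents (R : realType) (H : R -> R) (D p q : R) (k : nat) :
  continuous H -> 0 < D -> p <= q -> k%:R * D <= H p -> H q <= 0 ->
  exists b a : nat -> R,
    (forall j, (j < k)%N -> [/\ p <= b j, b j < a j, a j <= q,
       H (a j) - H (b j) = - D &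
       forall t, b j < t < a j -> j%:R * D < H t < j.+1%:R * D]) /\
    (forall phi : R -> R, {homo phi : s t / s <= t} ->
      \sum_(j < k) (phi (a j) - phi (b j)) <= phi q - phi p).
Proof.
move=> cH D0; elim: k p => [|k IH] p pq kp q0.
  exists (fun=> 0), (fun=> 0); split=> // phi hphi.
  by rewrite big_ord0 subr_ge0; exact: hphi.
have kD : k%:R * D < k.+1%:R * D by rewrite ltr_pM2r// ltr_nat.
have qk : H q <= k%:R * D by rewrite (le_trans q0)// mulr_ge0// ltW.
(* The top band, of index [k], is crossed first; the lower bands are crossed after [a], where [H] is
   exactly [k%:R * D]. *)
have [b [a [pb ba aq Hb [Ha Hba]]]] := first_descent cH kD pq kp qk.
have [|bs [as_ [bas phis]]] := IH a aq _ q0; first by rewrite Ha.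
exists (fun j => if j == k then b else bs j),
  (fun j => if j == k then a else as_ j).
split.
  move=> j; rewrite ltnS leq_eqVlt; case: eqP => [-> _|jk /= /bas[? ? ? ? ?]].
    by split=> //; rewrite Ha Hb -natr1; ring.
  by split=> //; rewrite (le_trans pb)// (le_trans (ltW ba)).
move=> phi hphi; rewrite big_ord_recr/= eqxx.
rewrite (eq_bigr (fun j : 'I_k => phi (as_ j) - phi (bs j))); last first.
  by move=> j _; rewrite ltn_eqF.
have := phis _ hphi; have := hphi _ _ pb; lra.
Qed.

(** * Absolutely continuous functions *)

(** Continuous induction: some good time lies just below the supremum [T] of the good times, and
    [step] at [T] carries [P] from it to [Num.min b (T + r / 2)], which exceeds [T] unless [T = b].
    Letting [s] and [v] straddle [t] suits derivatives known only at [t]. *)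
Lemma segment_creep (R : realType) (P : R -> Prop) (a b : R) :
  a <= b -> P a ->
  (forall t, a <= t <= b -> exists2 r, 0 < r & forall s v,
     a <= s <= t -> t <= v <= b -> t - r < s -> v < t + r -> P s -> P v) ->
  P b.
Proof.
move=> ab Pa step; pose S := [set t | a <= t <= b /\ P t].
have Sa : S a by split=> //; rewrite lexx.
have hS : has_sup S by split; [exists a | exists b => t [/andP[]]].
set T := sup S.
have aT : a <= T by apply: ub_le_sup => //; exists b => t [/andP[]].
have Tb : T <= b by apply: ge_sup => [|t [/andP[]]//]; exists a.
have [|r r0 stepT] := step T; first by rewrite aT.
have [s [/andP[as_ sb] Ps] Ts] := sup_adherent r0 hS.
have sT : s <= T.
  by apply: ub_le_sup; [exists b => t [/andP[]] | split=> //; rewrite as_].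
pose v := Num.min b (T + r / 2).
have Tv : T <= v by rewrite le_min Tb lerDl divr_ge0// ltW.
have vb : v <= b by rewrite ge_min lexx.
have Pv : P v.
  apply: (stepT s) => //; rewrite ?as_ ?Tv//.
  by rewrite gt_min; apply/orP; right; lra.
have vT : v <= T.
  apply: ub_le_sup; first by exists b => t [/andP[]].
  by split=> //; rewrite vb (le_trans aT).
suff <- : v = b by [].
rewrite /v; apply/min_idPl; rewrite leNgt; apply/negP => Trb.
by move: vT; rewrite /v (min_idPr (ltW Trb)) gerDl leNgt divr_gt0.
Qed.

Lemma is_derive_bound (R : realType) (F : R -> R) (t l e : R) :
  is_derive t 1 F l -> 0 < e ->
  \forall w \near t, `|F w - F t - l * (w - t)| <= e * `|w - t|.
Proof.
move=> [dF lE] e0.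
have : h^-1 *: ((F \o shift t) (h *: 1) - F t) @[h --> 0^'] --> l.
  by rewrite -lE; exact: dF.
move=> /cvgrPdist_le/(_ _ e0)[/= r r0 rF].
near=> w; have [->|wt] := eqVneq w t.
  by rewrite !subrr mulr0 subr0 !normr0 mulr0.
have wt0 : w - t != 0 by rewrite subr_eq0.
have := rF (w - t); rewrite /= sub0r normrN wt0 => h.
have {h} : `|l - (w - t)^-1 *: (F ((w - t) *: 1 + t) - F t)| <= e.
  by apply: h => //; rewrite distrC; near: w; exact: nbhsx_ballx.
rewrite [(w - t) *: 1]mulr1 subrK => h.
rewrite -ler_pdivrMr ?normr_gt0// -normf_div; apply: le_trans h.
rewrite distrC le_eqVlt; apply/orP; left; apply/eqP; congr `|_|.
by rewrite mulrBl mulfK//; congr (_ - _); exact: mulrC.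
Unshelve. all: by end_near. Qed.

(* The bad times lie in an open set [U] too small for [F] to lose more than [e]
   on disjoint intervals of [U]; at the other times [F] loses at most [e] per
   unit of time. [P t] says that [F a - F t] splits accordingly. *)
Lemma absolutely_continuous_ndecr (R : realType) (F : R -> R) (a b : R) :
  a <= b -> absolutely_continuous a b F ->
  {ae (@lebesgue_measure R), forall t, a < t < b ->
    exists2 l, 0 <= l & is_derive t (1 : R) F l} ->
  F a <= F b.
Proof.
move=> ab acF [N [mN N0 subN]].
rewrite leNgt; apply/negP => Fba.
have ba0 : 0 < b - a + 1 by lra.
(* With this [e], the losses [e * (b - a)] at good times and less than [e] inside [U] add up to less
   than half of [F a - F b], a contradiction. *)
pose e := (F a - F b) / (2 * (b - a + 1)).
have e0 : 0 < e by rewrite divr_gt0 ?mulr_gt0// subr_gt0.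
have [d d0 acFd] := acF e e0.
(* The endpoints join the bad set because the derivative is only controlled strictly between
   them. *)
pose N' := N `|` [set a] `|` [set b].
have mN' : measurable N' by do 2 apply: measurableU => //.
have N'0 : lebesgue_measure N' = 0%E.
  rewrite measureU0// ?measureU0//; first exact: lebesgue_measure_set1.
    exact: measurableU.
  exact: lebesgue_measure_set1.
have [|U [oU N'U UN']] := lebesgue_regularity_outer mN' _ d0.
  by rewrite [ltLHS](_ : _ = 0%E).
have mU : measurable U by exact: open_measurable.
have Ud : (lebesgue_measure U < d%:E)%E.
  by rewrite -(setDKU N'U) measureU0//; exact: measurableD.
pose P t := exists m (s u : 'I_m -> R),
  [/\ forall k, a <= s k /\ s k <= u k /\ u k <= t,
     trivIset setT (fun k => [set` `]s k, u k[]),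
     ((\sum_(k < m) (u k - s k))%:E <=
        lebesgue_measure (U `&` `]a, t]))%E &
     F a - F t <= e * (t - a) + \sum_(k < m) `|F (u k) - F (s k)|].
suff [m [s [u [su tI sumU Fab]]]] : P b.
  have Fe : \sum_(k < m) `|F (u k) - F (s k)| < e.
    apply: acFd => //; rewrite -lte_fin (le_lt_trans sumU)// (le_lt_trans _ Ud)//.
    by apply: le_measure; rewrite ?inE//; exact: measurableI.
  have : F a - F b < e * (b - a + 1) by lra.
  have -> : e * (b - a + 1) = (F a - F b) / 2 by rewrite /e; field; rewrite gt_eqF.
  lra.
apply: (@segment_creep _ P a b) => //.
  exists 0%N, (fun=> 0), (fun=> 0); split => //.
  - by case.
  - by move=> [].
  - by rewrite big_ord0.
  - by rewrite big_ord0 !subrr mulr0 addr0.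
move=> t /andP[at_ tb]; have [Ut|Ut] := pselect (U t).
  have /nbhs_ballP[r /= r0 rU] := open_nbhs_nbhs (conj oU Ut).
  exists r => // s v /andP[as_ st] /andP[tv vb] ts vt.
  move=> [m [s' [u' [su tI sumU Fas]]]].
  pose x w (f : 'I_m -> R) (k : 'I_m.+1) :=
    if unlift ord_max k is Some k' then f k' else w.
  have xmax w f : x w f ord_max = w by rewrite /x unlift_none.
  have xlift w f k : x w f (lift ord_max k) = f k by rewrite /x liftK.
  have xwiden w f k : x w f (widen_ord (leqnSn m) k) = f k.
    have -> : widen_ord (leqnSn m) k = lift ord_max k.
      by apply: val_inj; rewrite /= /bump leqNgt ltn_ord.
    exact: xlift.
  have sv : s <= v by exact: le_trans tv.
  exists m.+1, (x s s'), (x v u'); split.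
  - move=> k; case: (unliftP ord_max k) => [k' ->|->]; rewrite ?xmax ?xlift//.
    by have [? [? ?]] := su k'; do 2 split => //; exact: le_trans sv.
  - have disj k w : u' k <= s -> s' k < w < u' k -> s < w < v -> False.
      by move=> us /andP[_ wu] /andP[sw _]; have := lt_trans sw wu; rewrite ltNge us.
    apply/trivIsetP => k1 k2 _ _ k12; rewrite -subset0 => w.
    move: k12.
    case: (unliftP ord_max k1) => [k1' ->|->];
      case: (unliftP ord_max k2) => [k2' ->|->]; rewrite ?xmax ?xlift//= !in_itv/=.
    + rewrite (inj_eq lift_inj) => k12.
      have /trivIsetP/(_ k1' k2' I I k12) := tI.
      by rewrite -subset0 => /(_ w); rewrite /= !in_itv/=.
    + by move=> _ [h1 h2]; apply: (disj _ _ _ h1 h2); have [_ []] := su k1'.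
    + by move=> _ [h1 h2]; apply: (disj _ _ _ h2 h1); have [_ []] := su k2'.
    + by rewrite eqxx.
  - rewrite big_ord_recr/= !xmax (eq_bigr (fun k => u' k - s' k)); last first.
      by move=> k _; rewrite !xwiden.
    have svE : lebesgue_measure (`]s, v]%classic : set R) = (v - s)%:E.
      rewrite lebesgue_measure_itv/= lte_fin; case: ltP => // vs.
      by rewrite (_ : v = s) ?subrr//; apply/le_anti; rewrite vs sv.
    (* Lengths add up because []s, v]] lies in [U] and is disjoint from []a, s]]. *)
    rewrite EFinD -svE; apply: (@le_trans _ _
        (lebesgue_measure ((U `&` `]a, s]) `|` (`]s, v]%classic : set R)))%E).
      rewrite measureU//; [exact: leeD|exact: measurableI|].
      rewrite -subset0 => w [[_]]/=; rewrite !in_itv/= => /andP[_ ws] /andP[sw _].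
      by move: sw; rewrite ltNge ws.
    apply: le_measure; rewrite ?inE;
      [by apply: measurableU => //; exact: measurableI|exact: measurableI|].
    move=> w [[Uw]|]/=; rewrite !in_itv/= => /andP[h1 h2].
      by split=> //; rewrite h1 (le_trans h2).
    split; last by rewrite h2 (le_lt_trans as_).
    by apply: rU; rewrite /ball/= ltr_norml; apply/andP; split; lra.
  - rewrite big_ord_recr/= !xmax (eq_bigr (fun k => `|F (u' k) - F (s' k)|)); last first.
      by move=> k _; rewrite !xwiden.
    have := ler_norm (- (F v - F s)); rewrite normrN.
    have := ler_wpM2l (ltW e0) sv; lra.
have tab : a < t < b.
  rewrite !lt_neqAle at_ tb !andbT; apply/andP.
  by split; apply/eqP => E; apply/Ut/N'U; [left; right|right].
have [l l0 /is_derive_bound/(_ e0)] : exists2 l, 0 <= l & is_derive t (1 : R) F l.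
  apply: contrapT => h; apply: Ut; apply: N'U; left; left; apply: subN => /=.
  by move=> /(_ tab).
move=> /nbhs_ballP[r /= r0 rF].
exists r => // s v /andP[as_ st] /andP[tv vb] ts vt.
move=> [m [s' [u' [su tI sumU Fas]]]]; exists m, s', u'; split => //.
- move=> k; have [? [? ?]] := su k.
  by do 2 split => //; rewrite (le_trans _ tv)// (le_trans _ st).
- apply: (le_trans sumU).
  apply: le_measure; rewrite ?inE; [exact: measurableI|exact: measurableI|].
  move=> w [Uw]/=; rewrite !in_itv/= => /andP[-> ws]; split=> //=.
  by rewrite (le_trans ws)// (le_trans st).
(* The expansions of [F] at [t] towards [s] and towards [v] add up to [F s - F v <= e * (v - s)],
   since the linear terms have the favourable sign. *)
- have bs : ball t r s by rewrite /ball/= ltr_norml; apply/andP; split; lra.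
  have bv : ball t r v by rewrite /ball/= ltr_norml; apply/andP; split; lra.
  have := rF _ bs; have := rF _ bv; rewrite !ler_norml.
  rewrite (ger0_norm (x := v - t)) ?subr_ge0// (ler0_norm (x := s - t)) ?subr_le0//.
  have l1 : 0 <= l * (v - t) by rewrite mulr_ge0// subr_ge0.
  have l2 : 0 <= l * (t - s) by rewrite mulr_ge0// subr_ge0.
  move=> /andP[h1 _] /andP[_ h2]; lra.
Qed.

Lemma is_derive_comp_curve (R : realType) (V W : normedModType R)
    (h : V -> W) (X : R -> V) (t : R) (v : V) :
  differentiable h (X t) -> is_derive t (1 : R) X v ->
  is_derive t (1 : R) (h \o X) ('D_v h (X t)).
Proof.
move=> dh [dX Xv]; have dX' := (derivable1_diffP X t).1 dX.
have dhX : differentiable (h \o X) t by exact: differentiable_comp.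
apply: DeriveDef; first exact/derivable1_diffP.
by rewrite [LHS]deriveE// diff_comp//= -(deriveE _ dX') Xv [RHS]deriveE.
Qed.

Lemma derive_coordE (R : realType) (m : nat) (h : 'cV[R]_m -> R)
    (y v : 'cV[R]_m) :
  differentiable h y ->
  'D_v h y = \sum_(k < m) v k 0 * 'D_(delta_mx k 0) h y.
Proof.
move=> dh; rewrite deriveE// {1}(matrix_sum_delta v) linear_sum.
apply: eq_bigr => k _; rewrite big_ord1 linearZ/= deriveE//.
Qed.

(** Near [y] each partial derivative exceeds its size at [y] by at most 1. The mean value theorem on
    the segment from [w] to [z], which stays in the ball by convexity, then gives the sum of these
    bounds as Lipschitz constant. *)
Lemma C1_locally_lipschitz (R : realType) (m : nat) (h : 'cV[R]_m -> R) :
  (forall y, differentiable h y) -> (forall v, continuous (fun y => 'D_v h y)) ->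
  forall y, exists L, exists2 r, 0 < r & forall z w, ball y r z -> ball y r w ->
    `|h z - h w| <= L * `|z - w|.
Proof.
move=> dh ch y.
have : \forall z \near y, forall k : 'I_m,
    `|'D_(delta_mx k 0) h z| <= `|'D_(delta_mx k 0) h y| + 1.
  apply: (@filter_forall _ _ (fun k z => `|'D_(delta_mx k 0) h z| <=
    `|'D_(delta_mx k 0) h y| + 1) (nbhs y)) => k.
  have /cvgrPdist_le/(_ _ ltr01) := ch (delta_mx k 0) y.
  apply: filterS => z; rewrite distrC => h1.
  by rewrite -lerBlDl (le_trans _ h1)// lerB_dist.
move=> /nbhs_ballP[r /= r0 rD].
exists (\sum_(k < m) (`|'D_(delta_mx k 0) h y| + 1)), r => // z w yz yw.
pose X (s : R) := s *: (z - w) + w.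
have dX s : is_derive s (1 : R) X (z - w).
  have dl : is_derive s (1 : R) ( *:%R ^~ (z - w)) (z - w).
    have dl := is_diff_scalel s (z - w).
    apply: DeriveDef; first by apply: diff_derivable; exact: ex_diff.
    by rewrite deriveE ?diff_val ?scale1r//; exact: ex_diff.
  rewrite -[z - w]addr0 (_ : X = ( *:%R ^~ (z - w)) + cst w)//.
  exact: is_deriveD.
have dhX s : is_derive s (1 : R) (h \o X) ('D_(z - w) h (X s)).
  exact: is_derive_comp_curve.
have cX : {within `[0, 1], continuous (h \o X)}.
  apply: continuous_subspaceT => s; apply: differentiable_continuous.
  apply/derivable1_diffP; exact: ex_derive.
have [s s01] := MVT_segment ler01 (fun s _ => dhX s) cX.
rewrite /= /X scale1r scale0r add0r subrK subr0 mulr1 => ->.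
rewrite derive_coordE// mulr_suml (le_trans (ler_norm_sum _ _ _))//.
apply: ler_sum => k _; rewrite normrM mulrC; apply: ler_pM => //.
  apply: rD; move: yz yw; rewrite -!ball_normE/= => yz yw.
  have -> : y - (s *: (z - w) + w) = s *: (y - z) + (1 - s) *: (y - w).
    rewrite !scalerBr !scalerBl !scale1r; apply/matrixP => i j; rewrite !mxE; ring.
  move: s01; rewrite in_itv/= => /andP[s0 s1].
  rewrite (le_lt_trans (ler_normD _ _))// !normrZ !ger0_norm ?subr_ge0//.
  have := ler_wpM2l s0 (ltW yz); have := yw; have := yz.
  move: s0; rewrite le_eqVlt => /predU1P[<-|s0].
    by rewrite !mul0r subr0 mul1r add0r.
  have : s * `|y - z| < s * r by rewrite ltr_pM2l.
  have s1' : 0 <= 1 - s by lra.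
  have := fun h => ler_wpM2l s1' (ltW h); move=> h1 h2 _ /h1 h3 _; lra.
rewrite [leRHS]/Num.Def.normr/= mx_normrE.
exact: (le_bigmax _ (fun ij : 'I_m * 'I_1 => `|(z - w) ij.1 ij.2|) (k, 0)).
Qed.

Lemma absolutely_continuous_unif (R : realType) (V : normedModType R) (a b : R)
    (X : R -> V) (e : R) :
  absolutely_continuous a b X -> 0 < e ->
  exists2 d, 0 < d & forall s t, a <= s <= b -> a <= t <= b -> `|s - t| < d ->
    `|X s - X t| < e.
Proof.
move=> acX e0; have [d d0 dX] := acX _ e0; exists d => //.
suff H s t : a <= s -> t <= b -> s <= t -> t - s < d -> `|X t - X s| < e.
  move=> s t /andP[as_ sb] /andP[at_ tb]; have [st|ts] := leP s t.
    by rewrite ler0_norm ?subr_le0// opprB [in `|X s - _|]distrC; exact: H.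
  by rewrite gtr0_norm ?subr_gt0//; apply: H => //; exact: ltW.
move=> as_ tb st std.
have := dX 1%N (fun=> s) (fun=> t); rewrite !big_ord1; apply => //.
by apply/trivIsetP => i j _ _; rewrite !ord1.
Qed.

(** Compactness of [[a, b]] makes the local Lipschitz bounds uniform along the curve: one large [L]
    serves as Lipschitz constant and its inverse as the admissible time distance. *)
Lemma absolutely_continuous_comp (R : realType) (V : normedModType R) (a b : R)
    (h : V -> R) (X : R -> V) :
  (forall y, exists L, exists2 r, 0 < r & forall z w, ball y r z -> ball y r w ->
    `|h z - h w| <= L * `|z - w|) ->
  absolutely_continuous a b X -> absolutely_continuous a b (h \o X).
Proof.
move=> hL acX.
have : \forall L \near +oo, `[a, b] `<=` fun t => forall s u : R,
    a <= s <= b -> a <= u <= b -> `|s - t| < L^-1 -> `|u - t| < L^-1 ->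
    `|h (X s) - h (X u)| <= L * `|X s - X u|.
  have /compact_near_coveringP := @segment_compact R a b; apply => t /=.
  rewrite in_itv/= => tab; have [L0 [r r0 hr]] := hL (X t).
  have [d d0 dX] := absolutely_continuous_unif acX r0.
  have d2 : 0 < d / 2 by rewrite divr_gt0.
  near=> t' L => s u sab uab /= sL uL.
  have L0' : 0 < L by near: L; exact: nbhs_pinfty_gt.
  have L0L : L0 <= L by near: L; apply: nbhs_pinfty_ge; exact: num_real.
  have Ld : L^-1 < d / 2.
    by rewrite invf_plt ?posrE//; near: L; apply: nbhs_pinfty_gt; exact: num_real.
  have t't : `|t - t'| < d / 2 by near: t'; exact: nbhsx_ballx.
  have inb v : a <= v <= b -> `|v - t'| < L^-1 -> ball (X t) r (X v).
    move=> vab vL; rewrite -ball_normE/=; apply: dX => //.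
    rewrite distrC -(subrKA t') (le_lt_trans (ler_normD _ _))//.
    by rewrite (splitr d) ltrD// ?(lt_trans vL)// distrC.
  rewrite (le_trans (hr _ _ (inb _ sab sL) (inb _ uab uL)))// ler_wpM2r//.
move=> [L0 [_ L0P]]; pose L := Num.max (L0 + 1) 1.
have L00 : 0 < L by rewrite lt_max ltr01 orbT.
have {}L0P := L0P L; rewrite lt_max ltrDl ltr01/= in L0P.
have {L0P} LP s u : a <= s <= b -> a <= u <= b -> `|u - s| < L^-1 ->
    `|h (X u) - h (X s)| <= L * `|X u - X s|.
  move=> sab uab us; apply: (L0P isT s); rewrite ?in_itv//=.
  by rewrite subrr normr0 invr_gt0.
move=> e e0; have eL : 0 < e / L by rewrite divr_gt0.
have [d d0 dX] := acX _ eL.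
exists (Num.min d L^-1); first by rewrite lt_min d0 invr_gt0.
move=> m s t st tI; rewrite lt_min => /andP[sumd sumL].
have := dX m s t st tI sumd; rewrite ltr_pdivlMr// mulrC mulr_sumr.
apply: le_lt_trans; apply: ler_sum => k _ /=.
have [as_ [sk tb]] := st k.
apply: LP; rewrite ?as_ ?tb ?(le_trans sk)//= ?(le_trans as_)//.
rewrite ger0_norm ?subr_ge0// (le_lt_trans _ sumL)//.
rewrite (bigD1 k)//= lerDl sumr_ge0// => i _; rewrite subr_ge0.
by have [_ []] := st i.
Unshelve. all: by end_near. Qed.

Lemma absolutely_continuousD (R : realType) (V : normedModType R) (a b : R)
    (F G : R -> V) :
  absolutely_continuous a b F -> absolutely_continuous a b G ->
  absolutely_continuous a b (fun t => F t + G t).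
Proof.
move=> acF acG e e0; have e2 : 0 < e / 2 by rewrite divr_gt0.
have [d d0 dF] := acF _ e2; have [d' d'0 dG] := acG _ e2.
exists (Num.min d d'); first by rewrite lt_min d0.
move=> m s t st tI; rewrite lt_min => /andP[sumd sumd'].
have := ltrD (dF m s t st tI sumd) (dG m s t st tI sumd').
rewrite -splitr -big_split/=; apply: le_lt_trans; apply: ler_sum => k _.
by rewrite opprD addrACA ler_normD.
Qed.

Lemma lipschitz_absolutely_continuous (R : realType) (V : normedModType R)
    (a b L : R) (F : R -> V) :
  (forall s t, `|F t - F s| <= L * `|t - s|) -> absolutely_continuous a b F.
Proof.
move=> FL e e0; pose L' := Num.max L 1.
have L0 : 0 < L' by rewrite lt_max ltr01 orbT.
exists (e / L'); first by rewrite divr_gt0.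
move=> m s t st _; rewrite ltr_pdivlMr// mulrC mulr_sumr.
apply: le_lt_trans; apply: ler_sum => k _.
have [_ [sk _]] := st k.
rewrite (le_trans (FL _ _))// ger0_norm ?subr_ge0// ler_wpM2r ?subr_ge0//.
by rewrite le_max lexx.
Qed.

Lemma absolutely_continuous_sub (R : realType) (V : normedModType R)
    (a b a' b' : R) (F : R -> V) :
  a <= a' -> b' <= b ->
  absolutely_continuous a b F -> absolutely_continuous a' b' F.
Proof.
move=> aa bb acF e /acF[d d0 dF]; exists d => // m s t st; apply: dF => k.
by have [? []] := st k; split; [exact: le_trans aa _|split=> //; exact: le_trans bb].
Qed.

(** * Derivatives by blocks of the state *)

Lemma is_derive_mxcol (R : realType) (N : nat) (n : 'I_N -> nat)
    (x : R -> state R n) (w : forall i, 'cV[R]_(n i)) (t : R) :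
  (forall i, is_derive t (1 : R) (fun s => submxcol (x s) i) (w i)) ->
  is_derive t (1 : R) x (\mxcol_i w i).
Proof.
move=> dx.
have xE k j : (fun s => x s k j) =
    (fun s => submxcol (x s) (tagnat.sig1 k) (tagnat.sig2 k) j).
  by apply/funext => s; rewrite mxE tagnat.sig2K.
have dxt : derivable x t 1.
  apply/derivable_mxP => k j; rewrite xE.
  have /derivable_mxP := @ex_derive _ _ _ _ _ _ _ (dx (tagnat.sig1 k)).
  exact.
apply: DeriveDef => //; rewrite derive_mx//; apply/matrixP => k j.
rewrite !mxE xE.
have [/derive_mx h <-] := dx (tagnat.sig1 k).
by rewrite h mxE.
Qed.

Lemma derive_block_grad (R : realType) (N : nat) (n : 'I_N -> nat)
    (h : state R n -> R) (y : state R n) (w : forall i, 'cV[R]_(n i)) :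
  differentiable h y ->
  'D_(\mxcol_i w i) h y = \sum_(i < N) (block_grad h i y *m w i) 0 0.
Proof.
move=> dh; rewrite derive_coordE// -summxE -mul_mxrow_mxcol mxE.
by apply: eq_bigr => k _; rewrite !mxE tagnat.sig2K mulrC.
Qed.

(** * Attack intervals and the loss in one band *)

(** As a function of [t] this is a clock that runs at unit speed on [[p, q]] and stands still
    elsewhere, so its increment from [b] to [a] is the time that [[b, a]] shares with [[p, q]]. It
    also serves to freeze a trajectory outside its time segment. *)
Definition clamp (R : realType) (p q t : R) : R := Num.min (Num.max t p) q.

Section clamp.
Context {R : realType}.
Variables (p q : R).
Hypothesis pq : p <= q.

Lemma clamp_id t : p <= t <= q -> clamp p q t = t.
Proof.
by move=> /andP[pt tq]; rewrite /clamp (max_idPl pt) (min_idPl tq).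
Qed.

Lemma clamp_left t : t <= p -> clamp p q t = p.
Proof. by move=> tp; rewrite /clamp (max_idPr tp) (min_idPl pq). Qed.

Lemma clamp_right t : q <= t -> clamp p q t = q.
Proof. by move=> qt; rewrite /clamp min_r// le_max qt. Qed.

Lemma clamp_itv t : p <= clamp p q t <= q.
Proof. by rewrite /clamp ge_min lexx orbT le_min le_max lexx orbT pq. Qed.

Lemma clamp_homo : {homo clamp p q : s t / s <= t}.
Proof.
move=> s t st; rewrite /clamp le_min ge_min ge_min lexx orbT andbT.
by rewrite ge_max !le_max st lexx orbT.
Qed.

Lemma clamp_lipschitz s t : `|clamp p q t - clamp p q s| <= `|t - s|.
Proof.
wlog st : s t / s <= t => [h|].
  have [/h//|/ltW/h] := leP s t; by rewrite distrC (distrC t).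
rewrite ger0_norm ?subr_ge0 ?clamp_homo// ger0_norm ?subr_ge0//.
have [tp|/ltW pt] := leP t p.
  by rewrite !clamp_left ?(le_trans st)// subrr subr_ge0.
have [qs|/ltW sq] := leP q s.
  by rewrite !clamp_right ?(le_trans _ st)// subrr subr_ge0.
have [ps|/ltW sp] := leP p s; have [tq|/ltW qt] := leP t q.
- by rewrite !clamp_id ?ps ?pt.
- by rewrite (clamp_right qt) clamp_id ?ps//; lra.
- by rewrite (clamp_left sp) clamp_id ?pt//; lra.
- by rewrite (clamp_left sp) (clamp_right qt); lra.
Qed.

Lemma continuous_clamp : continuous (clamp p q).
Proof.
move=> t; apply/cvgrPdist_lt => e e0.
apply: filterS (nbhsx_ballx t e e0) => s.
exact: le_lt_trans (clamp_lipschitz s t).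
Qed.

Lemma is_derive_clamp t : t != p -> t != q ->
  is_derive t 1 (clamp p q) (if p <= t <= q then 1 else 0).
Proof.
move=> tp tq; have [pt|pt] /= := leP p t; last first.
  apply: (@near_eq_is_derive _ _ _ (cst p)); near=> s.
  by rewrite clamp_left//; apply/ltW; near: s; exact: lt_nbhsl.
have {tp}pt : p < t by rewrite lt_neqAle eq_sym tp.
have [qt|qt] := leP t q; last first.
  apply: (@near_eq_is_derive _ _ _ (cst q)); near=> s.
  by rewrite clamp_right//; apply/ltW; near: s; exact: lt_nbhsr.
have {tq}qt : t < q by rewrite lt_neqAle tq.
apply: (@near_eq_is_derive _ _ _ id); near=> s.
rewrite clamp_id//; apply/andP; split; apply/ltW; near: s.
  exact: lt_nbhsr.
exact: lt_nbhsl.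
Unshelve. all: by end_near. Qed.

End clamp.

(** This replaces a compromise interval, possibly empty and with any kind of endpoints, by a closed
    segment to which a clock can be attached. An empty interval becomes a degenerate segment, of
    length 0. *)
Lemma itv_endpoints (R : realType) (J : interval R) (a b T : R) :
  a <= b -> 0 <= T -> [set` J] `<=` [set` `[a, b]] ->
  (lebesgue_measure [set` J] <= T%:E)%E ->
  exists p q, [/\ p <= q, q - p <= T & forall t, t \in J -> p <= t <= q].
Proof.
move=> ab T0 Jab JT.
have [J0|/set0P[t0 Jt0]] := eqVneq [set` J] set0.
  exists a, a; split; rewrite ?subrr// => t tJ.
  by have : [set` J] t by []; rewrite J0.
case: J Jab JT Jt0 => -[bp p|[]] [bq q|[]] _; rewrite lebesgue_measure_itv/= => JT;
  last 8 first.
(* An interval with an infinite endpoint is either empty or of infinite measure. *)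
all: try by rewrite in_itv/= ?andbF//.
all: try by move: JT; rewrite ?ltry ?ltNyr /=.
move=> Jt0; have inJ t : t \in Interval (BSide bp p) (BSide bq q) -> p <= t <= q.
  by case: bp bq {JT Jt0} => -[]; rewrite in_itv/= => /andP[h1 h2]; apply/andP;
    split=> //; exact: ltW.
have /andP[pt tq] := inJ _ Jt0; have pq := le_trans pt tq.
exists p, q; split => //; move: JT; rewrite lte_fin.
by case: ltP => [_|qp _]; [rewrite lee_fin|rewrite (le_trans _ T0)// subr_le0].
Qed.

(** Subtract from [H] the function [G] that integrates the lower bound on its derivative. The
    difference is nondecreasing, and the term [kappa * (a - b)] in the increment of [G] makes the
    inequality strict. *)
Lemma descent_loss (R : realType) (N : nat) (H : R -> R) (b a kappa : R)
    (rho p q : 'I_N -> R) :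
  b < a -> 0 < kappa -> absolutely_continuous b a H ->
  (forall i, p i <= q i) ->
  {ae (@lebesgue_measure R), forall t, b < t < a -> exists2 l,
    kappa + \sum_(i < N) rho i * (if p i <= t <= q i then 1 else 0) <= l &
    is_derive t (1 : R) H l} ->
  \sum_(i < N) rho i * (clamp (p i) (q i) a - clamp (p i) (q i) b) < H a - H b.
Proof.
move=> ba k0 acH pq dH.
pose G t := kappa * t + \sum_(i < N) rho i * clamp (p i) (q i) t.
suff : H b + - G b <= H a + - G a.
  have -> : \sum_(i < N) rho i * (clamp (p i) (q i) a - clamp (p i) (q i) b) =
      G a - G b - kappa * (a - b).
    under eq_bigr do rewrite mulrBr.
    rewrite sumrB /G; ring.
  have : 0 < kappa * (a - b) by rewrite mulr_gt0// subr_gt0.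
  lra.
apply: (@absolutely_continuous_ndecr _ (fun t => H t + - G t)); first exact: ltW.
  apply: absolutely_continuousD => //.
  apply: (@lipschitz_absolutely_continuous _ _ _ _
    (kappa + \sum_(i < N) `|rho i|)) => s t.
  have -> : - G t - - G s = - (kappa * (t - s) +
      \sum_(i < N) rho i * (clamp (p i) (q i) t - clamp (p i) (q i) s)).
    under [in RHS]eq_bigr do rewrite mulrBr.
    rewrite sumrB /G; ring.
  rewrite normrN (le_trans (ler_normD _ _))// mulrDl lerD//.
    by rewrite normrM gtr0_norm.
  rewrite mulr_suml (le_trans (ler_norm_sum _ _ _))//; apply: ler_sum => i _.
  by rewrite normrM ler_wpM2l// clamp_lipschitz.
(* The clocks may fail to be derivable at their endpoints, which form a null set. *)
have ends i : {ae (@lebesgue_measure R), forall t, t != p i /\ t != q i}.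
  exists ([set p i] `|` [set q i]); split.
  - exact: measurableU.
  - by rewrite measureU0//; exact: lebesgue_measure_set1.
  - move=> t /=; have [->|tp] := eqVneq t (p i); first by left.
    by have [->|tq] := eqVneq t (q i); [right|move=> []].
have {}ends := filter_forall (ae_filter_ringOfSetsType _) ends.
apply: filterS2 ends dH => t ends dH /dH[l kl Hl].
exists (l - (kappa + \sum_(i < N) rho i * (if p i <= t <= q i then 1 else 0))).
  by rewrite subr_ge0.
apply: is_deriveB.
have dclamp i : is_derive t (1 : R) (rho i \*: clamp (p i) (q i))
    (rho i *: (if p i <= t <= q i then 1 else 0)).
  have [tp tq] := ends i; have := is_derive_clamp (pq i) tp tq.
  exact: is_deriveZ.
have -> : G = (kappa \*: @id R) + \sum_(i < N) (rho i \*: clamp (p i) (q i)).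
  by apply/funext => s; rewrite /G fctE fct_sumE.
rewrite -[X in is_derive _ _ _ (X + _)]mulr1; apply: is_deriveD.
Qed.

(** * Safety during the attack cycle *)

Theorem theorem3 (R : realType) (N : nat) (n r : 'I_N -> nat)
  (* dynamics and inputs *)
  (f : forall i : 'I_N, state R n -> 'cV[R]_(n i))
  (g : forall i : 'I_N, state R n -> 'M[R]_(n i, r i))
  (f_lip : forall i : 'I_N, lipschitz (f i))
  (g_lip : forall i : 'I_N, lipschitz (g i))
  (lo hi : forall i : 'I_N, 'cV[R]_(r i))
  (lo_lt_hi : forall (i : 'I_N) (j : 'I_(r i)), lo i j 0 < hi i j 0)
  (mu : forall i : 'I_N, state R n -> 'cV[R]_(r i))
  (mu_box : forall (i : 'I_N) (y : state R n),
    input_box (lo i) (hi i) (mu i y))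
  (* safety function and nominal policy *)
  (h : state R n -> R) (h_C1 : continuously_differentiable h)
  (c : R) (c_gt0 : 0 < c)
  (alpha : R -> R) (alpha_K : extended_class_K alpha)
  (tau : R) (tau_gt0 : 0 < tau)
  (nominal_in : forall y : state R n, superlevel h c y ->
    \sum_(i < N) (block_grad h i y *m (f i y + g i y *m mu i y)) 0 0
      >= - alpha (h y - c))
  (nominal_out : forall y : state R n,
    (superlevel h 0 `\` superlevel h c) y ->
    \sum_(i < N) (block_grad h i y *m (f i y + g i y *m mu i y)) 0 0
      >= c / tau)
  (* resilient architectures *)
  (A : finType) (trec : A -> R) (trec_ge0 : forall a : A, 0 <= trec a)
  (M : 'I_N -> A)
  (* bands and degradation *)
  (K : nat) (K_gt0 : (0 < K)%N) (Delta : R) (Delta_def : Delta = c / K%:R)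
  (rho : 'I_N -> 'I_K -> R)
  (rho_lt0 : forall (i : 'I_N) (j : 'I_K), rho i j < 0)
  (rho_bound : forall (i : 'I_N) (j : 'I_K) (y : state R n) (v : 'cV[R]_(r i)),
    band h (j%:R * Delta) (j.+1%:R * Delta) y ->
    input_box (lo i) (hi i) v ->
    (block_grad h i y *m g i y *m (v - mu i y)) 0 0 >= rho i j)
  (dom : forall i : 'I_N, degradation_dom Delta (rho i) (trec (M i)))
  (budget : \sum_(i < N) degradation Delta (rho i) (trec (M i)) + c >= 0)
  (* attack cycle *)
  (t0 tf : R) (t0_le_tf : t0 <= tf)
  (comp : 'I_N -> interval R)
  (u : forall i : 'I_N, R -> 'cV[R]_(r i)) (x : R -> state R n)
  (cycle : attack_cycle lo hi mu (fun i => trec (M i)) t0 tf comp u x)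
  (traj : trajectory f g t0 tf u x)
  (x_t0 : superlevel h c (x t0)) :
  forall t : R, t0 <= t <= tf -> superlevel h 0 (x t).
Proof.
have D0 : 0 < Delta by rewrite Delta_def divr_gt0// ltr0n.
have KD : K%:R * Delta = c by rewrite Delta_def mulrC mulfVK// pnatr_eq0 -lt0n.
have [dh ch] := h_C1; have [acx dx] := traj.
(* Freezing [x] outside [t0, tf] makes it continuous on the whole line. *)
pose X t := x (clamp t0 tf t); pose H t := h (X t).
have HE t : t0 <= t <= tf -> H t = h (x t) by move=> tt; rewrite /H /X clamp_id.
have cX : continuous X.
  move=> t; apply/cvgrPdist_lt => e e0.
  have [d d0 xd] := absolutely_continuous_unif acx e0.
  apply: filterS (nbhsx_ballx t d d0) => s ts; apply: xd; rewrite ?clamp_itv//.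
  exact: le_lt_trans (clamp_lipschitz t0_le_tf s t) ts.
have cH : continuous H.
  move=> t; apply: (@continuous_comp _ _ _ X h); first exact: cX.
  exact: differentiable_continuous.
have acH : absolutely_continuous t0 tf H.
  apply: absolutely_continuous_comp; first exact: C1_locally_lipschitz.
  move=> e /acx[d d0 xd]; exists d => // m s t st tI sumd.
  rewrite (eq_bigr (fun k => `|x (t k) - x (s k)|)); first exact: xd.
  move=> k _; have [as_ [sk tb]] := st k.
  by rewrite /X !clamp_id// ?as_ ?(le_trans sk)// (le_trans as_).
have /choice[p /choice[q pqP]] i : exists p q, [/\ p <= q, q - p <= trec (M i) &
    forall t, t \in comp i -> p <= t <= q].
  by have [sub len _ _ _] := cycle i; exact: (itv_endpoints t0_le_tf).
move=> tstar tstarP; rewrite /superlevel/= leNgt; apply/negP => hneg.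
have /andP[t0s stf] := tstarP.
have [||b [a [abP phiP]]] := @band_descents R H Delta t0 tstar K cH D0 t0s.
- by rewrite KD HE ?lexx.
- by rewrite HE// ltW.
(* The time that the segment [[p i, q i]] around the compromise of subsystem [i] shares with the
   [j]-th descent. *)
pose tau' i (j : 'I_K) := clamp (p i) (q i) (a j) - clamp (p i) (q i) (b j).
suff : \sum_(i < N) degradation Delta (rho i) (trec (M i)) < - (K%:R * Delta).
  by rewrite KD => ?; lra.
apply: (@sum_degradation_lt _ _ _ _ _ _ tau') => //.
- move=> i; have [-> /=] := dom i; case: eqP => [K1 h1|_]; last exact: ltW.
  by move: h1; rewrite -K1.
- move=> i j; have [_ /ltW ba _ _ _] := abP j (ltn_ord j).
  by rewrite subr_ge0 clamp_homo.
(* The descents are disjoint, so the clock of subsystem [i] advances over all of them by at most its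
   total run [q i - p i]. *)
- move=> i; have [pq qpT _] := pqP i.
  rewrite (le_trans (phiP _ (@clamp_homo _ (p i) (q i))))//.
  rewrite (le_trans _ qpT)// lerB//.
    by have /andP[] := clamp_itv pq tstar.
  by have /andP[] := clamp_itv pq t0.
move=> j; have [t0b ba atf Hab Hband] := abP j (ltn_ord j).
rewrite -Hab; apply: (@descent_loss _ _ _ _ _ (c / tau)) => //.
- exact: divr_gt0.
- exact: absolutely_continuous_sub t0b (le_trans atf stf) acH.
- by move=> i; have [] := pqP i.
have := filter_forall (ae_filter_ringOfSetsType _) dx.
apply: filterS => t dxt /[dup] tba /andP[bt ta].
have t0tf : t0 < t < tf.
  by rewrite (le_lt_trans t0b bt) (lt_le_trans ta)// (le_trans atf).
have tt : t0 <= t <= tf by case/andP: t0tf => /ltW -> /ltW ->.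
have {}dxt := is_derive_mxcol (fun i => dxt i t0tf).
have {}dxt : is_derive t (1 : R) X (\mxcol_i (f i (x t) + g i (x t) *m u i t)).
  apply: near_eq_is_derive dxt; case/andP: t0tf => t0t ttf; near=> s.
  rewrite /X clamp_id//; apply/andP; split; apply/ltW; near: s.
    exact: lt_nbhsr.
  exact: lt_nbhsl.
have XE : X t = x t by rewrite /X clamp_id.
exists ('D_(\mxcol_i (f i (x t) + g i (x t) *m u i t)) h (X t)); last first.
  exact: is_derive_comp_curve.
rewrite XE derive_block_grad//.
have /andP[hj hj1] : j%:R * Delta < h (x t) < j.+1%:R * Delta.
  by rewrite -HE//; exact: Hband.
have splitE i : (block_grad h i (x t) *m (f i (x t) + g i (x t) *m u i t)) 0 0 =
    (block_grad h i (x t) *m (f i (x t) + g i (x t) *m mu i (x t))) 0 0 +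
    (block_grad h i (x t) *m g i (x t) *m (u i t - mu i (x t))) 0 0.
  rewrite -[u i t in LHS](subrKC (mu i (x t))) [g i (x t) *m _]mulmxDr addrA.
  by rewrite mulmxDr mulmxA mxE.
rewrite [leRHS](eq_bigr _ (fun i _ => splitE i)) big_split/= lerD//.
  (* The strict upper bound on [h] matters in the top band: it keeps [x t] out of the superlevel set
     of [c], where only the weaker nominal bound is available. *)
  apply: nominal_out; split; rewrite /superlevel/=.
    by rewrite (le_trans _ (ltW hj))// mulr_ge0// ltW.
  apply/negP; rewrite -ltNge (lt_le_trans hj1)// -KD ler_pM2r// ler_nat.
  exact: ltn_ord.
apply: ler_sum => i _; have [_ _ inpq] := pqP i.
have [_ _ _ ubox umu] := cycle i.
case: ifPn => [_|out].
  (* The segment [[p i, q i]] may contain times at which subsystem [i] is not compromised; the input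
     is then nominal, hence still in the box. *)
  rewrite mulr1; apply: rho_bound.
    by rewrite /band/= (ltW hj) (ltW hj1).
  have [tc|tc] := boolP (t \in comp i); first exact: ubox.
  by rewrite umu.
rewrite mulr0 umu// ?subrr ?mulmx0 ?mxE//.
by apply: contra out; exact: inpq.
Unshelve. all: by end_near. Qed.
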